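(* Let $X$, $Y$ be two Banach spaces and $T,S\in B(X,Y)$. Then the following statements are equivalent: (1) the linear pencil $\lambda\mapsto T-\lambda S$ has an analytic generalized resolvent on a neighborhood of zero; (2) $T$ has a generalized inverse $T^+$ and there exists a neighborhood $U$ of $0$ such that $X=N(T-\lambda S)\oplus R(T^+)$ for all $\lambda\in U$; (3) $T$ has a generalized inverse $T^+$ and there exists a neighborhood $U$ of $0$ such that $Y=R(T-\lambda S)\oplus N(T^+)$ for all $\lambda\in U$; (4) for any generalized inverse $T^+$ of $T$, there exists a neighborhood $U$ of $0$ such that $X=N(T-\lambda S)\oplus R(T^+)$ for all $\lambda\in U$; (5) for any generalized inverse $T^+$ of $T$, there exists a neighborhood $U$ of $0$ such that $Y=R(T-\lambda S)\oplus N(T^+)$ for all $\lambda\in U$. In this case, $$G(\lambda)=T^+(I-\lambda ST^+)^{-1}:\ Y\to X$$ is a generalized resolvent of $\lambda\mapsto T-\lambda S$ on a neighborhood of $0$.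
   Context: $B(X,Y)$ is the Banach space of bounded linear operators from $X$ into $Y$; $N(\cdot)$ and $R(\cdot)$ denote null space and range; $I$ is the identity operator; $\lambda$ and $\mu$ are complex numbers. A generalized inverse of $T\in B(X,Y)$ is an operator $T^+\in B(Y,X)$ with $TT^+T=T$ and $T^+TT^+=T^+$. For an open set $U$ in the complex plane, a function $U\ni\lambda\mapsto G(\lambda)\in B(Y,X)$ is called a generalized resolvent on $U$ of the linear pencil $\lambda\mapsto T-\lambda S$ if: (i) $(T-\lambda S)G(\lambda)(T-\lambda S)=T-\lambda S$ for all $\lambda\in U$; (ii) $G(\lambda)(T-\lambda S)G(\lambda)=G(\lambda)$ for all $\lambda\in U$; (iii) $G(\lambda)-G(\mu)=(\lambda-\mu)G(\lambda)SG(\mu)$ for all $\lambda,\mu\in U$. It is an analytic generalized resolvent if moreover $\lambda\mapsto G(\lambda)$ is analytic on $U$. Neighborhoods of $0$ are taken in the complex plane. $\oplus$ denotes the direct sum of subspaces.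
   Formalization: Statements (4) and (5) are taken to include that T has at least one generalized inverse; read literally they hold vacuously when T has none, and the equivalence with (1) then fails. *)

(* Defs.v *)
From HB Require Import structures.
From mathcomp Require Import all_boot all_order all_algebra.
From mathcomp Require Import complex.
From mathcomp Require Import all_classical all_reals all_analysis.

Set Implicit Arguments.
Unset Strict Implicit.
Unset Printing Implicit Defensive.

Import Order.TTheory GRing.Theory Num.Theory.
Import numFieldNormedType.Exports.

Local Open Scope classical_set_scope.
Local Open Scope ring_scope.
Local Open Scope complex_scope.

Reserved Notation "''B' ( X , Y )" (format "''B' ( X ,  Y )").
Reserved Notation "A ** B" (at level 40, left associativity).

(* The numClosedFieldType instance of numFieldNormedType is only found on a
   variable numClosedFieldType, not on the concrete type R[i]. *)
HB.instance Definition _ (R : realType) := NormedModule.copy R[i] R[i]^o.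

Section BoundedOperators.
Context {R : realType}.
Implicit Types X Y Z : normedModType R[i].

Definition bounded_linear X Y : {pred X -> Y} :=
  [pred f | `[< linear f /\ exists M : R[i], forall x, `|f x| <= M * `|x| >]].

Record boundedOp X Y := BoundedOp {
  bop_fun :> X -> Y;
  _ : bop_fun \in @bounded_linear X Y
}.

End BoundedOperators.

Notation "''B' ( X , Y )" := (boundedOp X Y) : type_scope.

Section BoundedOperatorModule.
Context {R : realType} {X Y : normedModType R[i]}.

Lemma bounded_linearP (f : X -> Y) :
  reflect (linear f /\ exists M : R[i], forall x, `|f x| <= M * `|x|)
          (f \in @bounded_linear R X Y).
Proof. exact: asboolP. Qed.

HB.instance Definition _ := [isSub for @bop_fun R X Y].
HB.instance Definition _ := [Choice of 'B(X, Y) by <:].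

Lemma bounded_linear_submod_closed : submod_closed (@bounded_linear R X Y).
Proof.
split.
  apply/bounded_linearP; split.
    by move=> a u v; rewrite /= /GRing.zero /= scaler0 addr0.
  by exists 0 => x; rewrite mul0r [_ x]/(0 : Y) normr0.
move=> a f g /bounded_linearP[lf [Mf hf]] /bounded_linearP[lg [Mg hg]].
apply/bounded_linearP; split.
  move=> b u v; rewrite -[LHS]/(a *: f (b *: u + v) + g (b *: u + v)).
  rewrite -[RHS]/(b *: (a *: f u + g u) + (a *: f v + g v)) lf lg.
  by rewrite !scalerDr !scalerA (mulrC a) !addrA; congr (_ + _); rewrite addrAC.
exists (`|a| * Mf + Mg) => x; rewrite -[_ x]/(a *: f x + g x).
rewrite (le_trans (ler_normD _ _))// normrZ mulrDl lerD// -mulrA.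
by rewrite ler_wpM2l.
Qed.

HB.instance Definition _ := GRing.isSubmodClosed.Build _ _
  (@bounded_linear R X Y) bounded_linear_submod_closed.
HB.instance Definition _ := [SubChoice_isSubLmodule of 'B(X, Y) by <:].

Lemma bopP (A B : 'B(X, Y)) : A =1 B -> A = B.
Proof. by move=> AB; apply/val_inj/funext. Qed.

Lemma bop_linear (A : 'B(X, Y)) : linear A.
Proof. by case: A => f /= /bounded_linearP[]. Qed.

HB.instance Definition _ (A : 'B(X, Y)) :=
  GRing.isLinear.Build R[i] X Y *:%R A (bop_linear A).

Lemma bop_bounded (A : 'B(X, Y)) : exists M : R[i], forall x, `|A x| <= M * `|x|.
Proof. by case: A => f /= /bounded_linearP[]. Qed.

(* Norms are valued in R[i] (in its nonnegative reals), where sup is not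
   available: the supremum is taken in R. *)
Definition opnorm (A : 'B(X, Y)) : R[i] :=
  (sup [set complex.Re `|A x| | x in [set x | `|x| <= 1]])%:C.

Let normRe (V : normedModType R[i]) (v : V) : `|v| = (complex.Re `|v|)%:C.
Proof. by rewrite RRe_real// ger0_real. Qed.

Lemma opnorm_has_sup (A : 'B(X, Y)) :
  has_sup [set complex.Re `|A x| | x in [set x | `|x| <= 1]].
Proof.
split; first by exists (complex.Re `|A 0|), 0; rewrite //= normr0.
have [M AM] := bop_bounded A; exists (complex.Re `|M|) => _ [x x1 <-].
rewrite -lecR -normRe RRe_real ?ger0_real//.
rewrite (le_trans (AM x))// (le_trans (real_ler_norm _))//.
  by rewrite ger0_real// (le_trans _ (AM x)).
by rewrite normrM normr_id ler_piMr.
Qed.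

Lemma opnorm_ge0 (A : 'B(X, Y)) : 0 <= opnorm A.
Proof.
rewrite ler0c; apply: ub_le_sup; first exact: (opnorm_has_sup A).2.
by exists 0; rewrite /= ?linear0 normr0.
Qed.

Lemma opnorm_bound (A : 'B(X, Y)) x : `|A x| <= opnorm A * `|x|.
Proof.
have [->|x0] := eqVneq x 0; first by rewrite linear0 !normr0 mulr0.
have nx0 : 0 < `|x| by rewrite normr_gt0.
have -> : `|A x| = `|A (`|x|^-1 *: x)| * `|x|.
  by rewrite linearZ normrZ normfV normr_id mulrAC mulVf ?mul1r// gt_eqF.
rewrite ler_wpM2r// [leLHS]normRe lecR.
apply: ub_le_sup; first exact: (opnorm_has_sup A).2.
by exists (`|x|^-1 *: x); rewrite //= normrZ normfV normr_id mulVf// gt_eqF.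
Qed.

Lemma opnorm_le (A : 'B(X, Y)) M :
  0 <= M -> (forall x, `|A x| <= M * `|x|) -> opnorm A <= M.
Proof.
move=> M0 AM; rewrite -[M]RRe_real ?ger0_real// lecR.
apply: ge_sup; first exact: (opnorm_has_sup A).1.
move=> _ [x /= x1 <-]; rewrite -lecR -normRe RRe_real ?ger0_real//.
by rewrite (le_trans (AM x))// ler_piMr.
Qed.

Lemma opnormD (A B : 'B(X, Y)) : opnorm (A + B) <= opnorm A + opnorm B.
Proof.
apply: opnorm_le => [|x]; first by rewrite addr_ge0 ?opnorm_ge0.
rewrite -[(A + B) x]/(A x + B x) mulrDl.
by rewrite (le_trans (ler_normD _ _))// lerD// opnorm_bound.
Qed.

Let opnormZ_le (l : R[i]) (A : 'B(X, Y)) : opnorm (l *: A) <= `|l| * opnorm A.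
Proof.
apply: opnorm_le => [|x]; first by rewrite mulr_ge0 ?opnorm_ge0.
by rewrite -[(l *: A) x]/(l *: A x) normrZ -mulrA ler_wpM2l// opnorm_bound.
Qed.

Lemma opnormZ (l : R[i]) (A : 'B(X, Y)) : opnorm (l *: A) = `|l| * opnorm A.
Proof.
apply/eqP; rewrite eq_le opnormZ_le/=.
have [->|l0] := eqVneq l 0; first by rewrite normr0 mul0r opnorm_ge0.
have := opnormZ_le l^-1 (l *: A).
by rewrite scalerA mulVf// scale1r normfV ler_pdivlMl ?normr_gt0.
Qed.

Lemma opnorm0_eq0 (A : 'B(X, Y)) : opnorm A = 0 -> A = 0.
Proof.
move=> A0; apply: bopP => x; rewrite -[RHS]/(0 : Y); apply/eqP.
by rewrite -normr_le0; have := opnorm_bound A x; rewrite A0 mul0r.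
Qed.

HB.instance Definition _ := Lmodule_isNormed.Build R[i] 'B(X, Y)
  opnormD opnormZ opnorm0_eq0.

End BoundedOperatorModule.

Section Composition.
Context {R : realType} {X Y Z : normedModType R[i]}.

Lemma bop_comp_subproof (A : 'B(Y, Z)) (B : 'B(X, Y)) :
  A \o B \in @bounded_linear R X Z.
Proof.
apply/bounded_linearP; split=> [a u v|]; first by rewrite /= !linearP.
exists (opnorm A * opnorm B) => x /=.
rewrite (le_trans (opnorm_bound A _))// -mulrA.
by rewrite ler_wpM2l ?opnorm_ge0 ?opnorm_bound.
Qed.

Definition bop_comp (A : 'B(Y, Z)) (B : 'B(X, Y)) : 'B(X, Z) :=
  BoundedOp (bop_comp_subproof A B).

Lemma bop_id_subproof : @id X \in @bounded_linear R X X.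
Proof.
by apply/bounded_linearP; split=> //; exists 1 => x; rewrite mul1r.
Qed.

Definition bop_id : 'B(X, X) := BoundedOp bop_id_subproof.

End Composition.

Notation "A ** B" := (bop_comp A B) : ring_scope.
Notation "\I" := bop_id : ring_scope.

Section Operators.
Context {R : realType} {X Y : normedModType R[i]}.

Definition nullspace (A : 'B(X, Y)) : set X := [set x | A x = 0].

Definition direct_sum (V : normedModType R[i]) (M N : set V) :=
  [set m + n | m in M & n in N] = setT /\ M `&` N = [set 0].

Definition is_inverse (A B : 'B(X, X)) := A ** B = \I /\ B ** A = \I.

Definition invertible (A : 'B(X, X)) := exists B, is_inverse A B.

(* Equal to 0 when A is not invertible. *)
Definition bop_inv (A : 'B(X, X)) : 'B(X, X) := xget 0 (is_inverse A).

Definition generalized_inverse (T : 'B(X, Y)) (Tp : 'B(Y, X)) :=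
  T ** Tp ** T = T /\ Tp ** T ** Tp = Tp.

Definition pencil (T S : 'B(X, Y)) (l : R[i]) : 'B(X, Y) := T - l *: S.

Definition generalized_resolvent (T S : 'B(X, Y)) (U : set R[i])
    (G : R[i] -> 'B(Y, X)) :=
  [/\ forall l, U l -> pencil T S l ** G l ** pencil T S l = pencil T S l,
      forall l, U l -> G l ** pencil T S l ** G l = G l
    & forall l m, U l -> U m -> G l - G m = (l - m) *: (G l ** S ** G m)].

End Operators.

Definition analytic_on (R : realType) (V : normedModType R[i])
    (f : R[i] -> V) (U : set R[i]) :=
  forall z0, U z0 -> exists a : nat -> V, \forall z \near z0,
    series (fun n => (z - z0) ^+ n *: a n) @ \oo --> f z.

(* Main.v *)
Require Import Defs.
From HB Require Import structures.
From mathcomp Require Import all_boot all_order all_algebra.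
From mathcomp Require Import complex.
From mathcomp Require Import all_classical all_reals all_analysis.

Set Implicit Arguments.
Unset Strict Implicit.
Unset Printing Implicit Defensive.

Import Order.TTheory GRing.Theory Num.Theory.
Import numFieldNormedType.Exports.

Local Open Scope classical_set_scope.
Local Open Scope ring_scope.
Local Open Scope complex_scope.

(* Given a generalized inverse T+ of T, the operator I - l S T+ is invertible
   for small l by the Neumann series, and G(l) = T+ (I - l S T+)^-1 satisfies
   G A G = G for A = T - l S together with the resolvent identity, whatever S
   is. Moreover N(G(l)) = N(T+) and R(G(l)) = R(T+), so each of the two direct
   sum decompositions at l is equivalent to the missing identity A G A = A; it
   is even enough that R(A) meets N(T+) trivially.
   Conversely, a generalized resolvent H is bounded near 0 by its resolvent
   identity. If y = (T - l S) x and T+ y = 0, then T x = l T T+ S x, hence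
   y = l (T T+ - I) S x; taking x = H(l) y gives |y| <= C |l| |y|, so y = 0 for
   small l. This works for every T+, which makes (1) imply (4) and (5).
   Analyticity is automatic: iterating H(z) = H(w) + (z - w) H(w) S H(z) yields
   the power series with coefficients (H(w) S)^n H(w). *)

(** * Pointwise evaluation and norm estimates for operators *)

Section OperatorEvaluation.
Context {R : realType} {X Y : normedModType R[i]}.

Lemma bop_subE (A B : 'B(X, Y)) x : (A - B) x = A x - B x.
Proof. by []. Qed.

Lemma bop_scaleE (a : R[i]) (A : 'B(X, Y)) x : (a *: A) x = a *: A x.
Proof. by []. Qed.

Lemma bop_idE x : (\I : 'B(X, X)) x = x.
Proof. by []. Qed.

Lemma pencilE (T S : 'B(X, Y)) l x : pencil T S l x = T x - l *: S x.
Proof. by []. Qed.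

Lemma ler_norm_bop (A : 'B(X, Y)) x : `|A x| <= `|A| * `|x|.
Proof. exact: opnorm_bound. Qed.

Lemma norm_bop_le (A : 'B(X, Y)) M :
  0 <= M -> (forall x, `|A x| <= M * `|x|) -> `|A| <= M.
Proof. exact: opnorm_le. Qed.

End OperatorEvaluation.

Section OperatorComposition.
Context {R : realType} {X Y Z : normedModType R[i]}.

Lemma bop_compE (A : 'B(Y, Z)) (B : 'B(X, Y)) x : (A ** B) x = A (B x).
Proof. by []. Qed.

Lemma norm_bop_comp (A : 'B(Y, Z)) (B : 'B(X, Y)) : `|A ** B| <= `|A| * `|B|.
Proof.
apply: norm_bop_le => [|x]; first by rewrite mulr_ge0.
rewrite (le_trans (ler_norm_bop A _))// -mulrA.
by rewrite ler_wpM2l// ler_norm_bop.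
Qed.

End OperatorComposition.

(** * Smallness estimates for complex-valued norms *)

Section SmallQuantities.
Context {R : realType}.

(** Nonnegative complex numbers are real, so taking real parts reduces the claim to a real geometric
    sequence. *)
Lemma expr_cvg0_complex (q c e : R[i]) : 0 <= q -> q < 1 -> 0 <= c -> 0 < e ->
  \forall n \near \oo, q ^+ n * c < e.
Proof.
move=> q0 q1 c0 e0.
have ReK (x : R[i]) : 0 <= x -> x = (complex.Re x)%:C.
  by move=> x0; rewrite RRe_real// ger0_real.
rewrite (ReK e (ltW e0)) (ReK q q0) (ReK c c0).
set q' := complex.Re q; set c' := complex.Re c; set e' := complex.Re e.
have q'1 : `|q'| < 1.
  by rewrite ger0_norm -?ltcR -?lecR -(ReK q q0).
have e'0 : 0 < e' by rewrite -ltcR -(ReK e (ltW e0)).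
have /cvgr0Pnorm_lt/(_ e' e'0) := cvg_geometric c' q'1.
apply: filterS => n /=; rewrite /geometric/= => h.
rewrite -rmorphXn -rmorphM ltcR mulrC.
exact: le_lt_trans (ler_norm _) h.
Qed.

Lemma near_dist_mul_lt (z M e : R[i]) : 0 <= M -> 0 < e ->
  \forall w \near z, `|w - z| * M < e.
Proof.
(* Dividing by [M + 1] covers the case [M = 0]. *)
move=> M0 e0; have M1 : 0 < M + 1 by rewrite ltr_wpDl.
have /nbhs_normP : nbhs z [set w | `|z - w| < e / (M + 1)].
  by apply/nbhs_normP; exists (e / (M + 1)); rewrite //= divr_gt0.
move=> [d /= d0 hd]; apply/nbhs_normP; exists d => //= w /hd/=.
rewrite distrC ltr_pdivlMr// => /(le_lt_trans _); apply.
by rewrite ler_wpM2l// lerDl.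
Qed.

Lemma near0_mul_lt (M e : R[i]) : 0 <= M -> 0 < e ->
  \forall w \near (0 : R[i]), `|w| * M < e.
Proof.
move=> M0 e0; apply: filterS (near_dist_mul_lt 0 M0 e0) => w.
by rewrite subr0.
Qed.

End SmallQuantities.

(** * Neumann series *)

Section Neumann.
Context {R : realType} {Y : completeNormedModType R[i]}.
Variable K : 'B(Y, Y).
Hypothesis K1 : `|K| < 1.

(** Picard iterates for v = y + K v, that is, partial sums of the Neumann series applied to y. *)
Let z (y : Y) n := iter n (fun v => y + K v) 0.

(** The bound c satisfies |y| + |K| c = c, so each iteration preserves it. *)
Let z_bound y n : `|z y n| <= `|y| / (1 - `|K|).
Proof.
have K1' : 0 < 1 - `|K| by rewrite subr_gt0.
elim: n => [|n IH]; first by rewrite normr0 divr_ge0 ?normr_ge0 ?(ltW K1').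
rewrite /z iterS -/(z y n) (le_trans (ler_normD _ _))//.
rewrite (le_trans (lerD (lexx _) (ler_norm_bop _ _)))//.
rewrite (le_trans (lerD (lexx _) (ler_wpM2l (normr_ge0 _) IH)))//.
rewrite -[X in X + _](divfK (lt0r_neq0 K1')).
by rewrite mulrBr mulr1 [`|K| * _]mulrC subrK.
Qed.

(** Each step of the iteration cancels y and applies K to the difference, which is thus K^n applied
    to [z y m]. *)
Let z_dist y n m : `|z y (n + m) - z y n| <= `|K| ^+ n * (`|y| / (1 - `|K|)).
Proof.
elim: n => [|n IH]; first by rewrite add0n subr0 expr0 mul1r z_bound.
rewrite addSn /z !iterS -/(z y n) -/(z y (n + m)) opprD addrACA subrr add0r.
rewrite -raddfB (le_trans (ler_norm_bop _ _))// exprS -mulrA.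
by rewrite ler_wpM2l.
Qed.

Let z_cvg y : cvgn (z y).
Proof.
apply/cauchy_cvgP/cauchy_exP => e e0.
have K1' : 0 < 1 - `|K| by rewrite subr_gt0.
have c0 : 0 <= `|y| / (1 - `|K|).
  by rewrite divr_ge0 ?normr_ge0 ?(ltW K1').
have [N _ hN] := expr_cvg0_complex (normr_ge0 K) K1 c0 e0.
exists (z y N); exists N => // n /= Nn; rewrite -ball_normE /ball_/= distrC.
rewrite -(subnKC Nn) (le_lt_trans (z_dist _ _ _))//.
by apply: hN => /=.
Qed.

Let fixpoint y : exists v, v - K v = y.
Proof.
exists (lim (z y @ \oo)); set v := lim _.
have zv : z y @ \oo --> v by exact: z_cvg.
apply/eqP; rewrite -subr_eq0 -normr_le0; apply/ler_addgt0Pl => e e0.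
rewrite addr0.
have e2 : 0 < e / 2 by rewrite divr_gt0.
have /cvgrPdist_lt/(_ _ e2)[N _ hN] := zv.
(* By the recursion y = z_(N+1) - K z_N, so the defect consists of two errors of the iteration, each
   below e / 2. *)
have -> : v - K v - y = (v - z y N.+1) - K (v - z y N).
  by rewrite /z iterS raddfB/= !opprD addrACA opprK addrNK addrAC.
rewrite (le_trans (ler_normB _ _))// (splitr e) lerD//.
  by apply/ltW/hN => /=.
rewrite (le_trans (ler_norm_bop _ _))// (le_trans _ (ltW (hN N (leqnn N))))//.
by rewrite ler_piMl// ltW.
Qed.

Lemma neumann_invertible : invertible (\I - K).
Proof.
have K1' : 0 < 1 - `|K| by rewrite subr_gt0.
(* The pointwise right inverse [g] carries no structure yet. The lower bound [lb] makes I - K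
   injective, whence [g] is linear and a left inverse; the same bound shows that [g] is bounded. *)
have [g gK] := choice fixpoint.
have lb v : `|v| <= (1 - `|K|)^-1 * `|v - K v|.
  rewrite mulrC ler_pdivlMr// mulrBr mulr1 lerBlDr.
  rewrite -{1}(subrK (K v) v) (le_trans (ler_normD _ _))// lerD2l mulrC.
  exact: ler_norm_bop.
have inj u v : u - K u = v - K v -> u = v.
  move=> uv; apply/eqP; rewrite -subr_eq0 -normr_le0.
  rewrite (le_trans (lb _))// raddfB/= opprD addrACA -opprD uv subrr.
  by rewrite normr0 mulr0.
have glin : linear g.
  move=> a u v; apply: inj; rewrite gK linearP/= -{1}(gK u) -{1}(gK v).
  by rewrite scalerBr opprD addrACA.
have gb : g \in @bounded_linear R Y Y.
  apply/bounded_linearP; split => //; exists (1 - `|K|)^-1 => y.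
  by rewrite (le_trans (lb _))// gK.
exists (BoundedOp gb); split; apply: bopP => y.
  by rewrite bop_compE bop_subE bop_idE /= gK.
by apply: inj; rewrite [LHS](gK ((\I - K) y)).
Qed.

End Neumann.

(** * Generalized inverses and direct sums *)

Section GeneralizedInverses.
Context {R : realType} {X Y : normedModType R[i]}.
Variables (A : 'B(X, Y)) (G : 'B(Y, X)).

(** G A is a projection with kernel N(A) and range R(G). *)
Lemma generalized_inverse_sum_ker :
  generalized_inverse A G -> direct_sum (nullspace A) (range G).
Proof.
move=> [AGA GAG]; split.
  apply/seteqP; split => // x _; exists (x - G (A x)).
    by rewrite /nullspace/= raddfB/= -[A (G (A x))]/((A ** G ** A) x) AGA subrr.
  by exists (G (A x)); [exists (A x)|rewrite subrK].
apply/seteqP; split => [x [/= Ax [y _ yx]]|_ ->]; last first.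
  by split; rewrite /nullspace/= ?raddf0//; exists 0; rewrite ?raddf0.
by rewrite -yx -GAG bop_compE yx bop_compE Ax raddf0.
Qed.

(** A G is a projection with range R(A) and kernel N(G). *)
Lemma generalized_inverse_sum_range :
  generalized_inverse A G -> direct_sum (range A) (nullspace G).
Proof.
move=> [AGA GAG]; split.
  apply/seteqP; split => // y _; exists (A (G y)); first by exists (G y).
  exists (y - A (G y)); last by rewrite addrC subrK.
  by rewrite /nullspace/= raddfB/= -[G (A (G y))]/((G ** A ** G) y) GAG subrr.
apply/seteqP; split => [y [[x _ xy] /= Gy]|_ ->]; last first.
  by split; rewrite /nullspace/= ?raddf0//; exists 0; rewrite ?raddf0.
by rewrite -xy -AGA !bop_compE xy Gy raddf0.
Qed.

Hypothesis GAG : G ** A ** G = G.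

(** A G A and A agree on N(A), where both vanish, and on R(G), because G A G = G. *)
Lemma sum_ker_generalized_inverse :
  direct_sum (nullspace A) (range G) -> generalized_inverse A G.
Proof.
move=> [sumT _]; split => //; apply: bopP => x.
have : setT x by [].
rewrite -sumT => -[n An [_ [y _ <-]] <-].
rewrite !bop_compE !raddfD/= An raddf0 add0r raddf0 add0r.
by rewrite -[G (A (G y))]/((G ** A ** G) y) GAG.
Qed.

(** The defect A G A x - A x lies in R(A), and G kills it because G A G = G. *)
Lemma cap_range_ker_generalized_inverse :
  range A `&` nullspace G `<=` [set 0] -> generalized_inverse A G.
Proof.
move=> cap0; split => //; apply: bopP => x; apply/eqP; rewrite -subr_eq0.
apply/eqP/cap0; split; first by exists (G (A x) - x); rewrite // raddfB.
rewrite /nullspace/= raddfB/=.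
by rewrite -[X in X - _]/((G ** A ** G) (A x)) GAG subrr.
Qed.

End GeneralizedInverses.

(** * The candidate resolvent G(l) = T+ (I - l S T+)^-1 *)

Section PerturbedInverse.
Context {R : realType} {X Y : normedModType R[i]}.
Variables (T S : 'B(X, Y)) (Tp : 'B(Y, X)).
Hypothesis TpP : generalized_inverse T Tp.

Definition perturbation l : 'B(Y, Y) := \I - l *: (S ** Tp).

Definition perturbed_inverse l : 'B(Y, X) := Tp ** bop_inv (perturbation l).

Lemma bop_invP (A : 'B(Y, Y)) : invertible A -> is_inverse A (bop_inv A).
Proof. by move=> [B AB]; exact: (xgetI 0 AB). Qed.

Section AtPoint.
Variable l : R[i].
Hypothesis inv_l : invertible (perturbation l).

Lemma perturbationE y : perturbation l y = y - l *: S (Tp y).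
Proof. by []. Qed.

Lemma bop_inv_perturbationK y :
  bop_inv (perturbation l) y - l *: S (perturbed_inverse l y) = y.
Proof.
have [CE _] := bop_invP inv_l.
by rewrite -[LHS]/((perturbation l ** bop_inv (perturbation l)) y) CE.
Qed.

Lemma perturbationK y : bop_inv (perturbation l) (perturbation l y) = y.
Proof.
have [_ EC] := bop_invP inv_l.
by rewrite -[LHS]/((bop_inv (perturbation l) ** perturbation l) y) EC.
Qed.

(** If either operator kills y, then I - l S T+ fixes y, hence so does its inverse, and both
    operators agree at y. *)
Lemma nullspace_perturbed_inverse :
  nullspace (perturbed_inverse l) = nullspace Tp.
Proof.
apply/seteqP; split => y y0.
  have {}y0 : perturbed_inverse l y = 0 := y0.
  have := bop_inv_perturbationK y; rewrite y0 raddf0 scaler0 subr0 => Ey.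
  by move: y0; rewrite bop_compE Ey.
have {}y0 : Tp y = 0 := y0.
have Cy : perturbation l y = y by rewrite perturbationE y0 raddf0 scaler0 subr0.
have := perturbationK y; rewrite Cy => Ey.
by rewrite /nullspace/= Ey.
Qed.

Lemma range_perturbed_inverse : range (perturbed_inverse l) = range Tp.
Proof.
apply/seteqP; split => _ [y _ <-].
  by exists (bop_inv (perturbation l) y).
by exists (perturbation l y); rewrite // bop_compE perturbationK.
Qed.

(** With E the inverse of I - l S T+, (T - l S) G(l) y = y + (T T+ - I) E y. The last term is killed
    by T+, hence by G(l), which has the same kernel. *)
Lemma perturbed_inverse_outer :
  perturbed_inverse l ** pencil T S l ** perturbed_inverse l
  = perturbed_inverse l.
Proof.
apply: bopP => y; set E := bop_inv (perturbation l).
have lSE : l *: S (perturbed_inverse l y) = E y - y.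
  by apply/eqP; rewrite eq_sym subr_eq addrC -subr_eq bop_inv_perturbationK.
rewrite bop_compE [X in X = _]bop_compE pencilE lSE opprB addrCA.
rewrite raddfD/= [X in _ + X](_ : _ = 0) ?addr0//.
have : nullspace Tp (T (Tp (E y)) - E y).
  rewrite /nullspace/= raddfB/=.
  by rewrite -[Tp (T (Tp _))]/((Tp ** T ** Tp) _) TpP.2 subrr.
by rewrite -nullspace_perturbed_inverse.
Qed.

Lemma perturbed_inverse_kerP :
  direct_sum (nullspace (pencil T S l)) (range Tp) <->
  generalized_inverse (pencil T S l) (perturbed_inverse l).
Proof.
rewrite -range_perturbed_inverse; split;
  last exact: generalized_inverse_sum_ker.
exact: sum_ker_generalized_inverse perturbed_inverse_outer.
Qed.

Lemma perturbed_inverse_rangeP :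
  direct_sum (range (pencil T S l)) (nullspace Tp) <->
  generalized_inverse (pencil T S l) (perturbed_inverse l).
Proof.
rewrite -nullspace_perturbed_inverse; split.
  by case=> _ cap0; apply: cap_range_ker_generalized_inverse;
    [exact: perturbed_inverse_outer|rewrite cap0].
exact: generalized_inverse_sum_range.
Qed.

End AtPoint.

Lemma perturbed_inverse_resolvent l m :
  invertible (perturbation l) -> invertible (perturbation m) ->
  perturbed_inverse l - perturbed_inverse m
  = (l - m) *: (perturbed_inverse l ** S ** perturbed_inverse m).
Proof.
move=> il im; apply: bopP => y.
rewrite bop_subE bop_scaleE !bop_compE.
set E := bop_inv _; set F := bop_inv _.
(* As y = [perturbation m (F y)], the left side is the difference of the two perturbations at [F y].
   Applying T+ E gives the identity. *)
have yE : y - perturbation l (F y) = (l - m) *: S (Tp (F y)).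
  rewrite -{1}(bop_inv_perturbationK im y) -/F perturbationE opprB addrC addrA.
  by rewrite subrK scalerBl.
have EK : E (perturbation l (F y)) = F y by exact: perturbationK.
move: (perturbation l (F y)) EK yE => c EK yE.
by rewrite -linearZ/= -linearZ/= -yE !raddfB/= EK.
Qed.

Lemma perturbed_inverse_generalized_resolvent (U : set R[i]) :
  (forall l, U l -> invertible (perturbation l)) ->
  (forall l, U l ->
     generalized_inverse (pencil T S l) (perturbed_inverse l)) ->
  generalized_resolvent T S U perturbed_inverse.
Proof.
move=> inv_U gi_U; split => [l /gi_U[]//|l /gi_U[]//|l m Ul Um].
by apply: perturbed_inverse_resolvent; exact: inv_U.
Qed.

End PerturbedInverse.

Lemma near_perturbation_invertible {R : realType} {X : normedModType R[i]}
    {Y : completeNormedModType R[i]} (S : 'B(X, Y)) (Tp : 'B(Y, X)) :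
  \forall l \near 0, invertible (perturbation S Tp l).
Proof.
have := near0_mul_lt (normr_ge0 (S ** Tp)) (@ltr01 R[i]).
by apply: filterS => l l1; apply: neumann_invertible; rewrite normrZ.
Qed.

(** * Consequences of the existence of a generalized resolvent *)

Section Resolvent.
Context {R : realType} {X Y : normedModType R[i]}.
Variables (T S : 'B(X, Y)) (U : set R[i]) (G : R[i] -> 'B(Y, X)).
Hypothesis GP : generalized_resolvent T S U G.

Lemma generalized_resolvent_inverse l :
  U l -> generalized_inverse (pencil T S l) (G l).
Proof. by case: GP => AGA GAG _ Ul; split; [exact: AGA|exact: GAG]. Qed.

Lemma pencil0 : pencil T S 0 = T.
Proof. by rewrite /pencil scale0r subr0. Qed.

(** In G(l) = G(0) + l G(l) S G(0), the last term has norm at most |G(l)| / 2 for small l and is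
    absorbed on the left. *)
Lemma generalized_resolvent_bounded : nbhs 0 U ->
  \forall l \near 0, `|G l| <= 2 * `|G 0|.
Proof.
move=> U0; have U00 : U 0 by exact: nbhs_singleton.
have M0 : 0 <= `|S| * `|G 0| by rewrite mulr_ge0.
have half0 : 0 < 2^-1 :> R[i] by rewrite invr_gt0.
have small := near0_mul_lt M0 half0.
near=> l.
have Ul : U l by near: l.
have ls : `|l| * (`|S| * `|G 0|) < 2^-1 by near: l.
have [_ _ /(_ l 0 Ul U00)] := GP; rewrite subr0 => GE.
have : `|G l| <= `|G 0| + `|G l| / 2.
  rewrite -{1}(subrK (G 0) (G l)) addrC (le_trans (ler_normD _ _))// lerD2l.
  rewrite GE normrZ.
  rewrite (le_trans (ler_wpM2l (normr_ge0 l) (norm_bop_comp _ _)))//.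
  rewrite (le_trans (ler_wpM2l (normr_ge0 l)
    (ler_wpM2r (normr_ge0 _) (norm_bop_comp _ _))))//.
  by rewrite -mulrA mulrCA ler_wpM2l// ltW.
rewrite {1}(splitr `|G l|) lerD2r ler_pdivrMr// => /le_trans; apply.
by rewrite mulrC.
Unshelve. all: by end_near. Qed.

Lemma near_cap_range_pencil_nullspace (Tp : 'B(Y, X)) : nbhs 0 U ->
  generalized_inverse T Tp ->
  \forall l \near 0, range (pencil T S l) `&` nullspace Tp `<=` [set 0].
Proof.
move=> U0 [TTpT _]; have Gb := generalized_resolvent_bounded U0.
pose M := `|(T ** Tp - \I) ** S| * (2 * `|G 0|).
have M0 : 0 <= M by rewrite !mulr_ge0.
have small := near0_mul_lt M0 (@ltr01 R[i]).
near=> l => _ [[x0 _ <-] Tpy].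
set y := pencil T S l x0.
have Ul : U l by near: l.
have lM : `|l| * M < 1 by near: l.
have Gl : `|G l| <= 2 * `|G 0| by near: l.
(* The preimage [x0] has uncontrolled norm; [G l y] is another preimage of y, of norm at most 2
   |G(0)| |y|. *)
have yE : y = pencil T S l (G l y).
  have [AGA _] := generalized_resolvent_inverse Ul.
  by rewrite -[RHS]/((pencil T S l ** G l ** pencil T S l) x0) AGA.
have {}Tpy : Tp y = 0 := Tpy.
clearbody y.
(* Apply T T+ to y = (T - l S) G(l) y, using T+ y = 0 and T T+ T = T. *)
have TE : T (G l y) = l *: T (Tp (S (G l y))).
  have : T (Tp (pencil T S l (G l y))) = 0 by rewrite -yE Tpy raddf0.
  rewrite pencilE !raddfB/= -[T (Tp (T _))]/((T ** Tp ** T) _) TTpT.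
  move=> /eqP; rewrite subr_eq0 => /eqP ->.
  by rewrite !linearZ.
have yE' : y = l *: ((T ** Tp - \I) ** S) (G l y).
  rewrite -[RHS]/(l *: (T (Tp (S (G l y))) - S (G l y))) scalerBr -TE.
  by rewrite {1}yE.
apply/eqP; rewrite -normr_le0; apply/negPn/negP => y0.
have {}y0 : 0 < `|y| by rewrite normr_gt0; move: y0; rewrite normr_le0.
have : `|y| <= `|l| * M * `|y|.
  rewrite {1}yE' normrZ -mulrA ler_wpM2l// (le_trans (ler_norm_bop _ _))//.
  rewrite -mulrA ler_wpM2l// (le_trans (ler_norm_bop _ _))//.
  by rewrite ler_wpM2r.
by rewrite -[leLHS]mul1r ler_pM2r// (lt_geF lM).
Unshelve. all: by end_near. Qed.

(** * Power series expansion of a generalized resolvent *)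

Section Analyticity.
Variable z0 : R[i].

Let pow n : 'B(X, X) := iter n (fun A => A ** (G z0 ** S)) \I.

Let norm_pow n : `|pow n| <= `|G z0 ** S| ^+ n.
Proof.
elim: n => [|n IH].
  by rewrite expr0; apply: norm_bop_le => // x; rewrite mul1r.
rewrite /pow iterS -/(pow n) (le_trans (norm_bop_comp _ _))// exprSr.
by rewrite ler_wpM2r.
Qed.

(** Exact remainder formula: substituting G(z) = G(z0) + (z - z0) G(z0) S G(z) into the remainder
    splits off the next term of the series. *)
Let partial_sum z n : U z0 -> U z ->
  G z - series (fun n => (z - z0) ^+ n *: (pow n ** G z0)) n
  = (z - z0) ^+ n *: (pow n ** G z).
Proof.
move=> Uz0 Uz; elim: n => [|n IH].
  rewrite seriesEnat/= big_geq// subr0 expr0 scale1r.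
  exact: bopP.
rewrite seriesSr opprD addrA IH -scalerBr exprSr -scalerA.
congr (_ *: _); apply: bopP => y.
rewrite bop_subE bop_scaleE !bop_compE -raddfB/= -linearZ/=.
have [_ _ /(_ z0 z Uz0 Uz)] := GP.
move=> /(congr1 (fun A : 'B(Y, X) => - A y)).
by rewrite bop_subE bop_scaleE opprB -scaleNr opprB => ->.
Qed.

Lemma generalized_resolvent_analytic_at : nbhs z0 U ->
  exists a : nat -> 'B(Y, X), \forall z \near z0,
    series (fun n => (z - z0) ^+ n *: a n) @ \oo --> G z.
Proof.
move=> Uz0; have Uz00 : U z0 by exact: nbhs_singleton.
exists (fun n => pow n ** G z0).
have small := near_dist_mul_lt z0 (normr_ge0 (G z0 ** S)) (@ltr01 R[i]).
near=> z.
have Uz : U z by near: z.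
(* This is the ratio of the geometric bound on the remainder. *)
have q1 : `|z - z0| * `|G z0 ** S| < 1 by near: z.
apply/cvgrPdist_lt => e e0.
have q0 : 0 <= `|z - z0| * `|G z0 ** S| by rewrite mulr_ge0.
apply: filterS (expr_cvg0_complex q0 q1 (normr_ge0 (G z)) e0) => n.
apply: le_lt_trans; rewrite partial_sum// normrZ normrX exprMn -mulrA.
rewrite ler_wpM2l ?exprn_ge0// (le_trans (norm_bop_comp _ _))//.
by rewrite ler_wpM2r.
Unshelve. all: by end_near. Qed.

End Analyticity.

Lemma generalized_resolvent_analytic : open U -> analytic_on G U.
Proof.
move=> oU z0 Uz0; apply: generalized_resolvent_analytic_at.
exact: open_nbhs_nbhs.
Qed.

End Resolvent.

Theorem corollary2p1 (R : realType) (X Y : completeNormedModType R[i])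
    (T S : 'B(X, Y)) :
  [<->
    (* (1) *)
    exists U : set R[i], open_nbhs 0 U /\
      exists G : R[i] -> 'B(Y, X),
        generalized_resolvent T S U G /\ analytic_on G U;
    (* (2) *)
    exists Tp : 'B(Y, X), generalized_inverse T Tp /\
      exists U : set R[i], nbhs 0 U /\
        forall l, U l -> direct_sum (nullspace (pencil T S l)) (range Tp);
    (* (3) *)
    exists Tp : 'B(Y, X), generalized_inverse T Tp /\
      exists U : set R[i], nbhs 0 U /\
        forall l, U l -> direct_sum (range (pencil T S l)) (nullspace Tp);
    (* (4) *)
    (exists Tp : 'B(Y, X), generalized_inverse T Tp) /\
    forall Tp : 'B(Y, X), generalized_inverse T Tp ->
      exists U : set R[i], nbhs 0 U /\
        forall l, U l -> direct_sum (nullspace (pencil T S l)) (range Tp);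
    (* (5) *)
    (exists Tp : 'B(Y, X), generalized_inverse T Tp) /\
    forall Tp : 'B(Y, X), generalized_inverse T Tp ->
      exists U : set R[i], nbhs 0 U /\
        forall l, U l -> direct_sum (range (pencil T S l)) (nullspace Tp)]
  /\
  ((exists U : set R[i], open_nbhs 0 U /\
      exists G : R[i] -> 'B(Y, X),
        generalized_resolvent T S U G /\ analytic_on G U) ->
   forall Tp : 'B(Y, X), generalized_inverse T Tp ->
     exists U : set R[i], [/\ open_nbhs 0 U,
       forall l, U l -> invertible (\I - l *: (S ** Tp)) &
       generalized_resolvent T S U
         (fun l => Tp ** bop_inv (\I - l *: (S ** Tp)))]).
Proof.
(* The pivot of the equivalences: for a fixed [Tp], either decomposition near 0 amounts to [gi Tp]
   near 0, which yields (1); and (1) yields it for every [Tp]. *)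
pose gi (Tp : 'B(Y, X)) l :=
  generalized_inverse (pencil T S l) (perturbed_inverse S Tp l).
pose P1 := exists U : set R[i], open_nbhs 0 U /\
  exists G : R[i] -> 'B(Y, X), generalized_resolvent T S U G /\ analytic_on G U.
have near_gi Tp : P1 -> generalized_inverse T Tp -> \forall l \near 0, gi Tp l.
  move=> [U [/open_nbhs_nbhs U0 [G [GP _]]]] TpP.
  have := near_perturbation_invertible S Tp.
  apply: filterS2 (near_cap_range_pencil_nullspace GP U0 TpP) => l cap0 inv_l.
  apply: cap_range_ker_generalized_inverse.
    exact: (perturbed_inverse_outer TpP inv_l).
  by rewrite nullspace_perturbed_inverse.
have resolvent Tp : (\forall l \near 0, gi Tp l) ->
    exists U : set R[i], [/\ open_nbhs 0 U,
      forall l, U l -> invertible (perturbation S Tp l) &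
      generalized_resolvent T S U (perturbed_inverse S Tp)].
  move=> giTp.
  have : nbhs 0 [set l | invertible (perturbation S Tp l) /\ gi Tp l].
    apply: filterS2 (near_perturbation_invertible S Tp) giTp.
    by move=> l; split.
  rewrite nbhsE => -[U U0 UP]; exists U; split => // [l /UP[]//|].
  by apply: perturbed_inverse_generalized_resolvent => l /UP[].
have P1_of_gi Tp : (\forall l \near 0, gi Tp l) -> P1.
  move=> /resolvent[U [U0 _ GP]]; exists U; split => //.
  exists (perturbed_inverse S Tp); split => //.
  by apply: (generalized_resolvent_analytic GP); case: U0.
have kerP Tp : generalized_inverse T Tp -> (\forall l \near 0, gi Tp l) <->
    exists U : set R[i], nbhs 0 U /\
      forall l, U l -> direct_sum (nullspace (pencil T S l)) (range Tp).
  move=> TpP; have inv_near := near_perturbation_invertible S Tp; split.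
    move=> giTp.
    exists [set l | direct_sum (nullspace (pencil T S l)) (range Tp)].
    split => //; apply: filterS2 inv_near giTp => l inv_l.
    by rewrite /gi -perturbed_inverse_kerP.
  move=> [U [U0 sumU]]; apply: filterS2 inv_near U0 => l inv_l /sumU.
  by rewrite perturbed_inverse_kerP.
have rangeP Tp : generalized_inverse T Tp -> (\forall l \near 0, gi Tp l) <->
    exists U : set R[i], nbhs 0 U /\
      forall l, U l -> direct_sum (range (pencil T S l)) (nullspace Tp).
  move=> TpP; have inv_near := near_perturbation_invertible S Tp; split.
    move=> giTp.
    exists [set l | direct_sum (range (pencil T S l)) (nullspace Tp)].
    split => //; apply: filterS2 inv_near giTp => l inv_l.
    by rewrite /gi -perturbed_inverse_rangeP.
  move=> [U [U0 sumU]]; apply: filterS2 inv_near U0 => l inv_l /sumU.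
  by rewrite perturbed_inverse_rangeP.
have P1_inverse : P1 -> exists Tp : 'B(Y, X), generalized_inverse T Tp.
  (* The pencil at 0 is T itself, so [G 0] is a generalized inverse of T. *)
  move=> [U [/open_nbhs_nbhs U0 [G [GP _]]]]; exists (G 0).
  rewrite -(pencil0 T S); apply: generalized_resolvent_inverse GP _ _.
  exact: nbhs_singleton.
split; last by move=> P1h Tp TpP; exact: resolvent (near_gi Tp P1h TpP).
tfae.
- move=> P1h; have [Tp TpP] := P1_inverse P1h.
  by exists Tp; split => //; apply/kerP => //; exact: near_gi.
- by move=> [Tp [TpP]] /kerP giTp; exists Tp; split => //; apply/rangeP => //;
    exact: giTp.
(* Passing from one generalized inverse to all of them goes through (1). *)
- move=> [Tp0 [TpP0]] /rangeP giTp0.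
  have P1h := P1_of_gi _ (giTp0 TpP0).
  split; first by exists Tp0.
  by move=> Tp TpP; apply/kerP => //; exact: near_gi.
- move=> [exTp kerTp]; split => // Tp TpP.
  by apply/rangeP => //; apply/kerP => //; exact: kerTp.
(* The existence clause supplies [Tp]; the universal clause alone would hold vacuously for a T
   without generalized inverse. *)
- move=> [[Tp TpP] rangeTp]; apply: (P1_of_gi Tp).
  by apply/rangeP => //; exact: rangeTp.
Qed.
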